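(* For every $n\ge1$, the catalan congruences of $\mathbf{ASM}_n$ are in bijection with the depth triangles of order $n$.
   Context: An alternating sign matrix (ASM) of order $n$ is an $n\times n$ matrix $A$ with entries in $\{-1,0,1\}$, all row and column sums $1$, and whose nonzero entries alternate in sign in each row and column. Its height function matrix (HFM) is $H_{i,j}=i+j-2\sum_{i'\le i,j'\le j}A_{i',j'}$, $0\le i,j\le n$. $\mathbf{ASM}_n$ is the set of ASMs of order $n$ ordered by entrywise comparison of HFMs; it is a distributive lattice. $\mathbf{Dyck}_n$ (Stanley lattice) is the set of Dyck paths of semilength $n$ ordered by $P\le Q$ iff $P$ stays weakly below $Q$. A catalan congruence is a lattice congruence of $\mathbf{ASM}_n$ (an equivalence relation compatible with $\vee$ and $\wedge$) whose quotient lattice is isomorphic to $\mathbf{Dyck}_n$. $\mathcal{D}_n$ is the set of triples $(y_1,y_2,y_3)\in\mathbb{N}^3$ with $y_1+y_2+y_3=n-2$. A depth triangle of order $n$ is a map $\delta:\mathcal{D}_n\to\mathbb{Z}$ such that $\delta(i,0,n-2-i)=0$ for all $0\le i\le n-2$, and $|\delta(y_1,y_2,y_3)-\delta(y_1,y_2-1,y_3+1)|=1=|\delta(y_1,y_2,y_3)-\delta(y_1+1,y_2-1,y_3)|$ for all $(y_1,y_2,y_3)\in\mathcal{D}_n$ with $y_2\ge1$. *)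

(* Defs.v *)
From HB Require Import structures.
From mathcomp Require Import all_boot all_order all_algebra zify.

Set Implicit Arguments.
Unset Strict Implicit.
Unset Printing Implicit Defensive.

Import Order.TTheory GRing.Theory Num.Theory.
Local Open Scope ring_scope.
Local Open Scope quotient_scope.

Definition lattice_iso d1 d2 (L : finLatticeType d1) (M : finLatticeType d2) :=
  [exists f : {ffun L -> M},
    [&& injectiveb f, [forall y, y \in codom f],
        [forall x, forall y, f (x `&` y)%O == (f x `&` f y)%O] &
        [forall x, forall y, f (x `|` y)%O == (f x `|` f y)%O]]].

Lemma lattice_isoP d1 d2 (L : finLatticeType d1) (M : finLatticeType d2) :
  reflect (exists f : L -> M,
             [/\ bijective f,
                 {morph f : x y / (x `&` y)%O >-> (x `&` y)%O} &
                 {morph f : x y / (x `|` y)%O >-> (x `|` y)%O}])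
          (lattice_iso L M).
Proof.
apply: (iffP existsP) => [[f /and4P[/injectiveP fI /forallP fS fM fJ]]|].
  exists f; split=> [||].
  - exists (fun y => iinv (fS y)) => [x|y]; last exact: f_iinv.
    by apply: fI; rewrite f_iinv.
  - by move=> x y; apply/eqP; move/forallP/(_ x)/forallP: fM; exact.
  - by move=> x y; apply/eqP; move/forallP/(_ x)/forallP: fJ; exact.
case=> f [[g fK gK] fM fJ]; exists (finfun f); apply/and4P; split.
- by apply/injectiveP=> x y; rewrite !ffunE; apply: (can_inj fK).
- by apply/forallP=> y; apply/codomP; exists (g y); rewrite ffunE gK.
- by apply/forallP=> x; apply/forallP=> y; rewrite !ffunE fM.
- by apply/forallP=> x; apply/forallP=> y; rewrite !ffunE fJ.
Qed.

Section Congruence.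
Context {d : Order.disp_t} (L : finLatticeType d).
Implicit Types (x y z : L) (th : {set L * L}).

Definition is_congruence th : bool :=
  [&& [forall x, (x, x) \in th],
      [forall x, forall y, ((x, y) \in th) ==> ((y, x) \in th)],
      [forall x, forall y, forall z,
         ((x, y) \in th) ==> ((y, z) \in th) ==> ((x, z) \in th)] &
      [forall x, forall x', forall y, forall y',
         ((x, x') \in th) ==> ((y, y') \in th) ==>
           (((x `&` y)%O, (x' `&` y')%O) \in th) &&
           (((x `|` y)%O, (x' `|` y')%O) \in th)]].

Record congruence :=
  Congruence { congr_set : {set L * L}; congr_setP : is_congruence congr_set }.

HB.instance Definition _ := [isSub for congr_set].
HB.instance Definition _ := [Finite of congruence by <:].

Definition congr (th : congruence) : rel L :=
  fun x y => (x, y) \in congr_set th.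

Variable th : congruence.

Lemma congr_refl : reflexive (congr th).
Proof. by case/and4P: (congr_setP th) => /forallP. Qed.

Lemma congr_sym : symmetric (congr th).
Proof.
case/and4P: (congr_setP th) => _ H _ _.
have S x y : congr th x y -> congr th y x.
  by move: H => /forallP/(_ x)/forallP/(_ y)/implyP.
by move=> x y; apply/idP/idP; exact: S.
Qed.

Lemma congr_trans : transitive (congr th).
Proof.
case/and4P: (congr_setP th) => _ _ H _ y x z xy yz.
by move: H => /forallP/(_ x)/forallP/(_ y)/forallP/(_ z)/implyP/(_ xy)/implyP; exact.
Qed.

Lemma congr_meet_join x x' y y' : congr th x x' -> congr th y y' ->
  congr th (x `&` y)%O (x' `&` y')%O /\ congr th (x `|` y)%O (x' `|` y')%O.
Proof.
move=> xx yy; case/and4P: (congr_setP th) => _ _ _.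
move=> /forallP/(_ x)/forallP/(_ x')/forallP/(_ y)/forallP/(_ y').
by move=> /implyP/(_ xx)/implyP/(_ yy)/andP.
Qed.

Definition congr_equiv : equiv_rel L :=
  EquivRel (congr th) congr_refl congr_sym congr_trans.

Definition quotient_lattice := {eq_quot congr_equiv}.

HB.instance Definition _ := EqQuotient.on quotient_lattice.
HB.instance Definition _ := Choice.on quotient_lattice.

Local Notation Q := quotient_lattice.

HB.instance Definition _ := Countable.copy Q (can_type (reprK : cancel (@repr _ Q) _)).
HB.instance Definition _ : isFinite Q := CanIsFinite (reprK : cancel (@repr _ Q) _).

Definition qmeet (a b : Q) : Q := \pi_Q (repr a `&` repr b)%O.
Definition qjoin (a b : Q) : Q := \pi_Q (repr a `|` repr b)%O.

Lemma congr_repr x : congr th (repr (\pi_Q x)) x.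
Proof. by apply/(@eqquotP _ (congr_equiv) Q); rewrite reprK. Qed.

Lemma qmeetE x y : qmeet (\pi_Q x) (\pi_Q y) = \pi_Q (x `&` y)%O.
Proof.
apply/(@eqquotP _ (congr_equiv) Q).
by case: (congr_meet_join (congr_repr x) (congr_repr y)).
Qed.

Lemma qjoinE x y : qjoin (\pi_Q x) (\pi_Q y) = \pi_Q (x `|` y)%O.
Proof.
apply/(@eqquotP _ (congr_equiv) Q).
by case: (congr_meet_join (congr_repr x) (congr_repr y)).
Qed.

Lemma qmeetC : commutative qmeet.
Proof. by move=> a b; rewrite /qmeet meetC. Qed.

Lemma qjoinC : commutative qjoin.
Proof. by move=> a b; rewrite /qjoin joinC. Qed.

Lemma qmeetA : associative qmeet.
Proof.
by move=> a b c; elim/quotW: a => x; elim/quotW: b => y; elim/quotW: c => z; rewrite (qmeetE y) (qmeetE x) (qmeetE x y) (qmeetE _ z) meetA.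
Qed.

Lemma qjoinA : associative qjoin.
Proof.
by move=> a b c; elim/quotW: a => x; elim/quotW: b => y; elim/quotW: c => z; rewrite (qjoinE y) (qjoinE x) (qjoinE x y) (qjoinE _ z) joinA.
Qed.

Lemma qjoinKI b a : qmeet a (qjoin a b) = a.
Proof.
by elim/quotW: a => x; elim/quotW: b => y; rewrite (qjoinE x y) (qmeetE x) joinKI.
Qed.

Lemma qmeetKU b a : qjoin a (qmeet a b) = a.
Proof.
by elim/quotW: a => x; elim/quotW: b => y; rewrite (qmeetE x y) (qjoinE x) meetKU.
Qed.

Definition qle (a b : Q) := qmeet a b == a.

Lemma qle_refl : reflexive qle.
Proof. by move=> a; elim/quotW: a => x; rewrite /qle (qmeetE x x) meetxx. Qed.

Lemma qle_anti : antisymmetric qle.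
Proof. by move=> a b /andP[/eqP ab /eqP ba]; rewrite -ab qmeetC ba. Qed.

Lemma qle_trans : transitive qle.
Proof. by move=> b a c /eqP ab /eqP bc; rewrite /qle -ab -qmeetA bc. Qed.

HB.instance Definition _ :=
  Order.Le_isPOrder.Build d Q qle_refl qle_anti qle_trans.
HB.instance Definition _ :=
  Order.POrder_isLattice.Build d Q qmeetC qjoinC qmeetA qjoinA
    qjoinKI qmeetKU (fun _ _ => erefl).

End Congruence.

Definition alternating (s : seq int) : bool :=
  sorted (fun x y => y == - x) [seq x <- s | x != 0].

Definition is_asm n (A : 'M[int]_n) : bool :=
  [&& [forall i, forall j, A i j \in [:: -1; 0; 1]],
      [forall i, \sum_j A i j == 1],
      [forall j, \sum_i A i j == 1],
      [forall i, alternating [seq A i j | j <- enum 'I_n]] &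
      [forall j, alternating [seq A i j | i <- enum 'I_n]]].

Record asm n := Asm { asm_mx :> 'M[int]_n; asm_mxP : is_asm asm_mx }.

HB.instance Definition _ n := [isSub for @asm_mx n].
HB.instance Definition _ n := [Countable of asm n by <:].

Section AsmFinite.
Variable n : nat.

Definition asm_code (A : asm n) : 'M[bool * bool]_n :=
  map_mx (fun x : int => (x == 1, x == -1)) (asm_mx A).
Definition asm_decode (B : 'M[bool * bool]_n) : option (asm n) :=
  insub (map_mx (fun b : bool * bool =>
    if b.1 then 1 else if b.2 then -1 else 0 : int) B).

Lemma asm_codeK : pcancel asm_code asm_decode.
Proof.
move=> A; rewrite /asm_decode /asm_code.
set B := map_mx _ _; have -> : B = asm_mx A; last exact: valK.
apply/matrixP=> i j; rewrite !mxE /=.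
have /and5P[/forallP/(_ i)/forallP/(_ j) + _ _ _ _] := asm_mxP A.
by rewrite !inE => /or3P[]/eqP->.
Qed.

HB.instance Definition _ : isFinite (asm n) := PCanIsFinite asm_codeK.
End AsmFinite.

(* Matrix indices start at 0: the i first rows are those of index < i. *)
Definition corner_sum n (A : 'M[int]_n) (i j : nat) : int :=
  \sum_(i' < n | (i' < i)%N) \sum_(j' < n | (j' < j)%N) A i' j'.

Definition hfm n (A : 'M[int]_n) : 'M[int]_n.+1 :=
  \matrix_(i, j) (i%:Z + j%:Z - 2 * corner_sum A i j).

Section AlternatingPartialSums.

Implicit Types (s : seq int) (b : bool).

Local Notation opp := (fun x y : int => y == - x).

Lemma alt_psum b s : all (mem [:: -1; 0; 1 : int]) s ->
    path opp (2 * b%:Z - 1) [seq x <- s | x != 0] ->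
  forall k, b%:Z + \sum_(x <- take k s) x \in [:: 0; 1].
Proof.
elim: s b => [|x s IH] b /=.
  by move=> _ _ k; rewrite big_nil addr0; case: b.
rewrite !inE => /andP[/or3P[]/eqP-> s1] /=.
- case: b => //= /(IH false s1) H [|k]; first by rewrite big_nil.
  by rewrite /= big_cons addrA H.
- move=> /(IH b s1) H [|k]; first by rewrite big_nil addr0; case: (b).
  by rewrite /= big_cons add0r H.
- case: b => //= /(IH true s1) H [|k]; first by rewrite big_nil.
  by rewrite /= big_cons addrA H.
Qed.

Lemma psum_alt b s :
    (forall k, b%:Z + \sum_(x <- take k s) x \in [:: 0; 1]) ->
  all (mem [:: -1; 0; 1 : int]) s /\
  path opp (2 * b%:Z - 1) [seq x <- s | x != 0].
Proof.
elim: s b => [|x s IH] b //= H.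
have := H 1%N; rewrite /= take0 big_cons big_nil addr0 => H1.
have [c cE] : exists c : bool, b%:Z + x = c%:Z.
  by move: H1; rewrite !inE => /orP[]/eqP->; [exists false | exists true].
have [k|s1 s2] := IH c.
  by have := H k.+1; rewrite /= big_cons addrA cE.
rewrite inE s1 andbT.
have xE : x = c%:Z - b%:Z by lia.
by move: s2; rewrite xE; case: (c); case: (b).
Qed.

Definition line s : bool :=
  [&& all (mem [:: -1; 0; 1 : int]) s, \sum_(x <- s) x == 1 & alternating s].

Lemma lineP s : reflect
  ((forall k, \sum_(x <- take k s) x \in [:: 0; 1]) /\ \sum_(x <- s) x = 1)
  (line s).
Proof.
apply: (iffP and3P) => [[s1 /eqP s2 s3]|[H H1]]; last first.
  have [|s1 s2] := @psum_alt false s; first by move=> k; rewrite add0r.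
  by split=> //; [rewrite H1 | exact: path_sorted s2].
split=> //.
suff s4 : path opp (2 * false%:Z - 1) [seq x <- s | x != 0].
  by move=> k; rewrite -[X in X \in _]add0r; exact: (alt_psum s1 s4).
elim: s s1 s2 s3 => [|x s IH] //=.
rewrite !inE big_cons => /andP[/or3P[]/eqP-> s1] //=; last first.
  by rewrite add0r; exact: IH.
rewrite /alternating /= => s2 s3; have := @alt_psum false s s1 s3 (size s).
by rewrite take_size !inE; move: (\sum_(y <- s) y) s2 => S s2 /orP[]/eqP s4; exfalso; lia.
Qed.

End AlternatingPartialSums.

Lemma take_enum_ord n k (f : 'I_n -> int) :
  \sum_(x <- take k [seq f j | j <- enum 'I_n]) x = \sum_(j < n | (j < k)%N) f j.
Proof.
rewrite -map_take big_map; have -> : take k (enum 'I_n) = [seq j : 'I_n <- enum 'I_n | (j < k)%N].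
  apply: (@inj_map _ _ (val : 'I_n -> nat) val_inj); rewrite map_take val_enum_ord.
  rewrite -(filter_map val (fun x => (x < k)%N)) val_enum_ord take_iota.
  have [kn|nk] := leqP k n.
    by rewrite (@filter_iota_ltn 0 n k).
  rewrite -[LHS]filter_predT; apply/eq_in_filter=> x.
  by rewrite mem_iota add0n => /andP[_ /= h]; rewrite (ltn_trans h).
by rewrite big_filter big_enum_cond.
Qed.

Section AsmLattice.
Variable n : nat.
Implicit Types (M : 'M[int]_n) (A B : asm n).

Lemma is_asmP M : reflect
  ((forall i, line [seq M i j | j <- enum 'I_n]) /\
   (forall j, line [seq M i j | i <- enum 'I_n])) (is_asm M).
Proof.
apply: (iffP and5P) => [[/forallP e /forallP r /forallP c /forallP ar /forallP ac]|[r c]].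
  split=> k; apply/and3P; split; rewrite ?big_map ?big_enum //=;
  by apply/allP=> _ /mapP[l _ ->]; exact: (forallP (e _)).
split; apply/forallP=> k.
- apply/forallP=> l; have /and3P[/allP h _ _] := r k.
  by apply: h; apply: map_f; rewrite mem_enum.
- by have /and3P[_ + _] := r k; rewrite big_map big_enum.
- by have /and3P[_ + _] := c k; rewrite big_map big_enum.
- by have /and3P[_ _] := r k.
- by have /and3P[_ _] := c k.
Qed.

Lemma corner_sum0l M j : corner_sum M 0 j = 0.
Proof. by rewrite /corner_sum big_pred0. Qed.

Lemma corner_sum_tr M i j : corner_sum M^T i j = corner_sum M j i.
Proof.
rewrite /corner_sum exchange_big /=; apply: eq_bigr => k _.
by apply: eq_bigr => l _; rewrite mxE.
Qed.

Lemma corner_sum0r M i : corner_sum M i 0 = 0.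
Proof. by rewrite -corner_sum_tr corner_sum0l. Qed.

Lemma corner_sumSl M (i : 'I_n) j :
  corner_sum M i.+1 j = corner_sum M i j + \sum_(j' < n | (j' < j)%N) M i j'.
Proof.
rewrite /corner_sum (bigD1 i) //= addrC; congr (_ + _).
by apply: eq_bigl => k; rewrite ltnS ltn_neqAle andbC.
Qed.

Lemma corner_sumSr M i (j : 'I_n) :
  corner_sum M i j.+1 = corner_sum M i j + \sum_(i' < n | (i' < i)%N) M i' j.
Proof.
rewrite -corner_sum_tr corner_sumSl corner_sum_tr; congr (_ + _).
by apply: eq_bigr => k _; rewrite mxE.
Qed.

Definition mx_of_corner (c : nat -> nat -> int) : 'M[int]_n :=
  \matrix_(i, j) (c i.+1 j.+1 - c i j.+1 - c i.+1 j + c i j).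

Lemma corner_sumK M : mx_of_corner (corner_sum M) = M.
Proof.
apply/matrixP=> i j; rewrite mxE !corner_sumSl.
have -> : \sum_(k < n | (k < j.+1)%N) M i k = M i j + \sum_(k < n | (k < j)%N) M i k.
  rewrite (bigD1 j) //=; congr (_ + _).
  by apply: eq_bigl => k; rewrite ltnS ltn_neqAle andbC.
lia.
Qed.

(* The corner sum functions of alternating sign matrices of order n, see
   [asm_corner] and [corner_asm]. *)
Definition corner_fun (c : nat -> nat -> int) : Prop :=
  [/\ (forall j, c 0%N j = 0), (forall i, c i 0%N = 0),
      (forall i, (i <= n)%N -> c i n = i%:Z),
      (forall j, (j <= n)%N -> c n j = j%:Z) &
      forall i j, (i < n)%N -> (j <= n)%N ->
        (c i.+1 j - c i j \in [:: 0; 1]) && (c j i.+1 - c j i \in [:: 0; 1])].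

Lemma psumD (f : nat -> int) k : (k <= n)%N ->
  \sum_(j < n | (j < k)%N) (f j.+1 - f j) = f k - f 0%N.
Proof.
move=> kn; rewrite -(big_ord_widen _ (fun j => f j.+1 - f j) kn).
by rewrite -(big_mkord xpredT (fun j => f j.+1 - f j)) telescope_sumr.
Qed.

Lemma psumE (g : 'I_n -> int) (f : nat -> int) k : (k <= n)%N ->
  f 0%N = 0 -> (forall j : 'I_n, g j = f j.+1 - f j) ->
  \sum_(j < n | (j < k)%N) g j = f k.
Proof.
move=> kn f0 gf; rewrite (eq_bigr (fun j : 'I_n => f j.+1 - f j)) //.
by rewrite psumD // f0 subr0.
Qed.

Lemma mx_of_cornerK c : corner_fun c ->
  forall i j, (i <= n)%N -> (j <= n)%N -> corner_sum (mx_of_corner c) i j = c i j.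
Proof.
case=> c0 c0' _ _ _ i j lin ljn; rewrite /corner_sum.
transitivity (\sum_(i' < n | (i' < i)%N) (c i'.+1 j - c i' j)).
  apply: eq_bigr => i' _.
  apply: (@psumE _ (fun j => c i'.+1 j - c i' j)) => // [|j'].
    by rewrite !c0' subrr.
  by rewrite mxE; lia.
by rewrite (psumD (fun i => c i j)) // c0 subr0.
Qed.

Lemma psum_minn (f : 'I_n -> int) k :
  \sum_(j < n | (j < k)%N) f j = \sum_(j < n | (j < minn k n)%N) f j.
Proof. by apply: eq_bigl => j; rewrite leq_min ltn_ord andbT. Qed.

Lemma asm_corner A : corner_fun (corner_sum A).
Proof.
have /is_asmP[r c] := asm_mxP A.
have r1 (i : 'I_n) : \sum_(j' < n | (j' < n)%N) A i j' = 1.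
  have /lineP[_] := r i; rewrite big_map big_enum /= => <-.
  by apply: eq_bigl => j; rewrite ltn_ord.
have c1 (j : 'I_n) : \sum_(i' < n | (i' < n)%N) A i' j = 1.
  have /lineP[_] := c j; rewrite big_map big_enum /= => <-.
  by apply: eq_bigl => i; rewrite ltn_ord.
split.
- exact: corner_sum0l.
- exact: corner_sum0r.
- elim=> [|i IH] lin; first exact: corner_sum0l.
  by rewrite (corner_sumSl _ (Ordinal lin)) /= IH ?(ltnW lin) // r1; lia.
- elim=> [|j IH] ljn; first exact: corner_sum0r.
  by rewrite (corner_sumSr _ _ (Ordinal ljn)) /= IH ?(ltnW ljn) // c1; lia.
move=> i j lin ljn; apply/andP; split.
  rewrite (corner_sumSl _ (Ordinal lin)) /= addrC addKr -take_enum_ord.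
  by case/lineP: (r (Ordinal lin)) => /(_ j).
rewrite (corner_sumSr _ _ (Ordinal lin)) /= addrC addKr.
rewrite -(take_enum_ord j (fun i' => A i' (Ordinal lin))).
by case/lineP: (c (Ordinal lin)) => /(_ j).
Qed.

Lemma corner_asm c : corner_fun c -> is_asm (mx_of_corner c).
Proof.
move=> cc; have [c0 c0' cn cn' cS] := cc.
have R (i : 'I_n) k : \sum_(j < n | (j < k)%N) mx_of_corner c i j =
    c i.+1 (minn k n) - c i (minn k n).
  have kn : (minn k n <= n)%N by rewrite geq_minr.
  rewrite psum_minn.
  apply: (@psumE _ (fun j => c i.+1 j - c i j)) => // [|j'].
    by rewrite !c0' subrr.
  by rewrite mxE; lia.
have C (j : 'I_n) k : \sum_(i < n | (i < k)%N) mx_of_corner c i j =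
    c (minn k n) j.+1 - c (minn k n) j.
  have kn : (minn k n <= n)%N by rewrite geq_minr.
  rewrite psum_minn.
  apply: (@psumE _ (fun i => c i j.+1 - c i j)) => // [|i'].
    by rewrite !c0 subrr.
  by rewrite mxE; lia.
have T (f : 'I_n -> int) : \sum_(x <- [seq f j | j <- enum 'I_n]) x =
    \sum_(j < n | (j < n)%N) f j.
  by rewrite -(take_enum_ord n) take_oversize // size_map size_enum_ord.
apply/is_asmP; split=> k; apply/lineP; split=> [l|].
- rewrite take_enum_ord R.
  by have /andP[] := cS k (minn l n) (ltn_ord k) (geq_minr _ _).
- by rewrite T R minnn !cn ?(ltnW (ltn_ord k)) ?ltn_ord //; lia.
- rewrite (take_enum_ord l (fun i => mx_of_corner c i k)) C.
  by have /andP[] := cS k (minn l n) (ltn_ord k) (geq_minr _ _).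
- rewrite (T (fun i => mx_of_corner c i k)) C minnn.
  by rewrite !cn' ?(ltnW (ltn_ord k)) ?ltn_ord //; lia.
Qed.

Definition asm_of_corner c (cc : corner_fun c) : asm n := Asm (corner_asm cc).

Lemma step01 (x y : int) : (y - x \in [:: 0; 1]) = (x <= y <= x + 1).
Proof. by rewrite !inE; lia. Qed.

Lemma step_min (x x' y y' : int) : x' - x \in [:: 0; 1] -> y' - y \in [:: 0; 1] ->
  Num.min x' y' - Num.min x y \in [:: 0; 1].
Proof.
rewrite !step01 => /andP[h1 h2] /andP[h3 h4].
by case: (leP x y) => h; case: (leP x' y') => h'; lia.
Qed.

Lemma step_max (x x' y y' : int) : x' - x \in [:: 0; 1] -> y' - y \in [:: 0; 1] ->
  Num.max x' y' - Num.max x y \in [:: 0; 1].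
Proof.
rewrite !step01 => /andP[h1 h2] /andP[h3 h4].
by case: (leP x y) => h; case: (leP x' y') => h'; lia.
Qed.

Lemma corner_min A B : corner_fun (fun i j =>
  Num.min (corner_sum A i j) (corner_sum B i j)).
Proof.
have [a1 a2 a3 a4 a5] := asm_corner A; have [b1 b2 b3 b4 b5] := asm_corner B.
split=> [j|i|i lin|j ljn|i j lin ljn].
- by rewrite a1 b1 minxx.
- by rewrite a2 b2 minxx.
- by rewrite a3 // b3 // minxx.
- by rewrite a4 // b4 // minxx.
have /andP[a6 a7] := a5 i j lin ljn; have /andP[b6 b7] := b5 i j lin ljn.
by rewrite !step_min.
Qed.

Lemma corner_max A B : corner_fun (fun i j =>
  Num.max (corner_sum A i j) (corner_sum B i j)).
Proof.
have [a1 a2 a3 a4 a5] := asm_corner A; have [b1 b2 b3 b4 b5] := asm_corner B.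
split=> [j|i|i lin|j ljn|i j lin ljn].
- by rewrite a1 b1 maxxx.
- by rewrite a2 b2 maxxx.
- by rewrite a3 // b3 // maxxx.
- by rewrite a4 // b4 // maxxx.
have /andP[a6 a7] := a5 i j lin ljn; have /andP[b6 b7] := b5 i j lin ljn.
by rewrite !step_max.
Qed.

Definition asm_meet A B : asm n := asm_of_corner (corner_max A B).
Definition asm_join A B : asm n := asm_of_corner (corner_min A B).

Definition asm_le A B : bool := [forall i, forall j, hfm A i j <= hfm B i j].

Lemma asm_leP A B : reflect
  (forall i j, (i <= n)%N -> (j <= n)%N -> corner_sum B i j <= corner_sum A i j)
  (asm_le A B).
Proof.
apply: (iffP forallP) => [H i j|H i].
  move=> lin ljn; have /forallP := H (Ordinal (lin : (i < n.+1)%N)).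
  move=> /(_ (Ordinal (ljn : (j < n.+1)%N))).
  by rewrite !mxE /=; lia.
apply/forallP=> j; rewrite !mxE; have := H i j (ltn_ord i) (ltn_ord j).
by lia.
Qed.

Lemma asm_le_refl : reflexive asm_le.
Proof. by move=> A; apply/asm_leP. Qed.

Lemma asm_le_anti : antisymmetric asm_le.
Proof.
move=> A B /andP[/asm_leP AB /asm_leP BA]; apply: val_inj => /=.
rewrite -(corner_sumK A) -(corner_sumK B); apply/matrixP=> i j; rewrite !mxE.
have E k l : (k <= n)%N -> (l <= n)%N -> corner_sum A k l = corner_sum B k l.
  by move=> kn ln; apply/eqP; rewrite eq_le AB ?BA.
by rewrite !E // ltnW.
Qed.

Lemma asm_le_trans : transitive asm_le.
Proof.
move=> B A C /asm_leP AB /asm_leP BC; apply/asm_leP=> i j lin ljn.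
by apply: le_trans (AB i j lin ljn); exact: BC.
Qed.

HB.instance Definition _ :=
  Order.Le_isPOrder.Build (Order.Disp tt tt) (asm n)
    asm_le_refl asm_le_anti asm_le_trans.

Lemma asm_meetP A B C :
  (A <= asm_meet B C)%O = (A <= B)%O && (A <= C)%O.
Proof.
apply/asm_leP/andP => [H|[/asm_leP AB /asm_leP AC] i j lin ljn]; last first.
  rewrite (mx_of_cornerK (corner_max B C)) // ge_max.
  by rewrite AB ?AC.
by split; apply/asm_leP=> i j lin ljn; have := H i j lin ljn;
  rewrite (mx_of_cornerK (corner_max B C)) // ge_max => /andP[].
Qed.

Lemma asm_joinP A B C :
  (asm_join A B <= C)%O = (A <= C)%O && (B <= C)%O.
Proof.
apply/asm_leP/andP => [H|[/asm_leP AB /asm_leP AC] i j lin ljn]; last first.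
  rewrite (mx_of_cornerK (corner_min A B)) // le_min.
  by rewrite AB ?AC.
by split; apply/asm_leP=> i j lin ljn; have := H i j lin ljn;
  rewrite (mx_of_cornerK (corner_min A B)) // le_min => /andP[].
Qed.

HB.instance Definition _ :=
  Order.POrder_MeetJoin_isLattice.Build (Order.Disp tt tt) (asm n)
    asm_meetP asm_joinP.

End AsmLattice.

(* A path is a sequence of steps, [true] being up and [false] down. *)

Definition height (s : seq bool) (k : nat) : int :=
  (count id (take k s))%:Z - (count negb (take k s))%:Z.

Definition is_dyck n (s : n.*2.-tuple bool) : bool :=
  [forall k : 'I_n.*2.+1, 0 <= height s k] && (height s n.*2 == 0).

Record dyck n := Dyck
  { dyck_path :> n.*2.-tuple bool; dyck_pathP : is_dyck dyck_path }.

HB.instance Definition _ n := [isSub for @dyck_path n].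
HB.instance Definition _ n := [Finite of dyck n by <:].

Section DyckLattice.
Variable n : nat.
Implicit Types (s : n.*2.-tuple bool) (P Q : dyck n).

Definition ups (s : seq bool) (k : nat) : nat := count id (take k s).

Lemma heightE s k : (k <= n.*2)%N -> height s k = 2 * (ups s k)%:Z - k%:Z.
Proof.
move=> kn; have := count_predC id (take k s).
rewrite size_take size_tuple -/(minn _ _) (minn_idPl kn) /height /ups.
by rewrite (eq_count (a1 := predC id) (a2 := negb)) //; lia.
Qed.

Definition ups_fun (u : nat -> nat) : Prop :=
  [/\ u 0%N = 0%N, u n.*2 = n, (forall k, (k < n.*2)%N -> u k <= u k.+1 <= (u k).+1)%N &
      forall k, (k <= n.*2)%N -> (k <= (u k).*2)%N].

Lemma upsS s k : (k < n.*2)%N -> ups s k.+1 = (ups s k + nth false s k)%N.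
Proof.
move=> kn; rewrite /ups (take_nth false) ?size_tuple // -cats1 count_cat /=.
by rewrite addn0.
Qed.

Lemma dyck_ups P : ups_fun (ups P).
Proof.
have /andP[/forallP h0 /eqP hn] := dyck_pathP P; split.
- by rewrite /ups take0.
- by move: hn; rewrite heightE //; lia.
- by move=> k kn; rewrite upsS //; case: nth; lia.
by move=> k kn; have := h0 (Ordinal (kn : (k < n.*2.+1)%N)); rewrite heightE //=; lia.
Qed.

Definition path_of (u : nat -> nat) : n.*2.-tuple bool :=
  [tuple u i.+1 != u i | i < n.*2].

Lemma path_ofK u : ups_fun u -> forall k, (k <= n.*2)%N -> ups (path_of u) k = u k.
Proof.
case=> u0 un uS _; elim=> [|k IH] kn; first by rewrite u0 /ups take0.
rewrite upsS // IH ?(ltnW kn) //.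
have -> : nth false (path_of u) k = (u k.+1 != u k).
  by rewrite -[k]/(val (Ordinal kn)) -tnth_nth tnth_mktuple.
by have := uS k kn; lia.
Qed.

Lemma path_of_dyck u : ups_fun u -> is_dyck (path_of u).
Proof.
move=> hu; have [_ un _ ud] := hu; apply/andP; split.
  apply/forallP=> k; have kn : (k <= n.*2)%N by rewrite -ltnS.
  by rewrite heightE // path_ofK //; have := ud k kn; lia.
by rewrite heightE // path_ofK // un; lia.
Qed.

Definition dyck_of u (hu : ups_fun u) : dyck n := Dyck (path_of_dyck hu).

Lemma ups_min P Q : ups_fun (fun k => minn (ups P k) (ups Q k)).
Proof.
have [p1 p2 p3 p4] := dyck_ups P; have [q1 q2 q3 q4] := dyck_ups Q.
split=> [||k kn|k kn]; [lia|lia| |].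
  by have := p3 k kn; have := q3 k kn; lia.
by have := p4 k kn; have := q4 k kn; lia.
Qed.

Lemma ups_max P Q : ups_fun (fun k => maxn (ups P k) (ups Q k)).
Proof.
have [p1 p2 p3 p4] := dyck_ups P; have [q1 q2 q3 q4] := dyck_ups Q.
split=> [||k kn|k kn]; [lia|lia| |].
  by have := p3 k kn; have := q3 k kn; lia.
by have := p4 k kn; have := q4 k kn; lia.
Qed.

Definition dyck_meet P Q : dyck n := dyck_of (ups_min P Q).
Definition dyck_join P Q : dyck n := dyck_of (ups_max P Q).

Definition dyck_le P Q : bool :=
  [forall k : 'I_n.*2.+1, height P k <= height Q k].

Lemma dyck_leP P Q : reflect
  (forall k, (k <= n.*2)%N -> (ups P k <= ups Q k)%N) (dyck_le P Q).
Proof.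
apply: (iffP forallP) => [H k kn|H k].
  by have := H (Ordinal (kn : (k < n.*2.+1)%N)); rewrite !heightE //=; lia.
have kn : (k <= n.*2)%N by rewrite -ltnS.
by have := H k kn; rewrite !heightE //; lia.
Qed.

Lemma dyck_le_refl : reflexive dyck_le.
Proof. by move=> P; apply/dyck_leP. Qed.

Lemma dyck_le_anti : antisymmetric dyck_le.
Proof.
move=> P Q /andP[/dyck_leP PQ /dyck_leP QP]; apply: val_inj; apply: val_inj.
apply: (@eq_from_nth _ false) => [|k]; rewrite !size_tuple // => kn.
have E l : (l <= n.*2)%N -> ups P l = ups Q l.
  by move=> ln; apply/eqP; rewrite eqn_leq PQ ?QP.
have := E k.+1 kn; rewrite !upsS // E ?(ltnW kn) // => /addnI.
by case: (nth _ _ _); case: (nth _ _ _).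
Qed.

Lemma dyck_le_trans : transitive dyck_le.
Proof.
move=> Q P S /dyck_leP PQ /dyck_leP QS; apply/dyck_leP=> k kn.
exact: leq_trans (PQ k kn) (QS k kn).
Qed.

HB.instance Definition _ :=
  Order.Le_isPOrder.Build (Order.Disp tt tt) (dyck n)
    dyck_le_refl dyck_le_anti dyck_le_trans.

Lemma dyck_meetP P Q S :
  (P <= dyck_meet Q S)%O = (P <= Q)%O && (P <= S)%O.
Proof.
apply/dyck_leP/andP => [H|[/dyck_leP PQ /dyck_leP PS] k kn]; last first.
  by rewrite (path_ofK (ups_min Q S)) // leq_min PQ ?PS.
by split; apply/dyck_leP=> k kn; have := H k kn;
  rewrite (path_ofK (ups_min Q S)) // leq_min => /andP[].
Qed.

Lemma dyck_joinP P Q S :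
  (dyck_join P Q <= S)%O = (P <= S)%O && (Q <= S)%O.
Proof.
apply/dyck_leP/andP => [H|[/dyck_leP PS /dyck_leP QS] k kn]; last first.
  by rewrite (path_ofK (ups_max P Q)) // geq_max PS ?QS.
by split; apply/dyck_leP=> k kn; have := H k kn;
  rewrite (path_ofK (ups_max P Q)) // geq_max => /andP[].
Qed.

HB.instance Definition _ :=
  Order.POrder_MeetJoin_isLattice.Build (Order.Disp tt tt) (dyck n)
    dyck_meetP dyck_joinP.

End DyckLattice.

Definition is_catalan n (th : congruence (asm n)) : bool :=
  lattice_iso (quotient_lattice th) (dyck n).

Record catalan_congruence n := CatalanCongruence
  { catalan_congr :> congruence (asm n); catalan_congrP : is_catalan catalan_congr }.

HB.instance Definition _ n := [isSub for @catalan_congr n].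
HB.instance Definition _ n := [Finite of catalan_congruence n by <:].

(* The triples (y1, y2, y3) of naturals with y1 + y2 + y3 = n - 2, the
   subtraction being in the integers: there are none when n < 2.  Each
   coordinate is at most n - 2, so it is harmless to take it in 'I_n. *)
Definition depth_index n :=
  {y : 'I_n * 'I_n * 'I_n | (y.1.1 + y.1.2 + y.2 + 2 == n)%N}.

HB.instance Definition _ n := Finite.on (depth_index n).

Definition y1 n (y : depth_index n) : nat := (val y).1.1.
Definition y2 n (y : depth_index n) : nat := (val y).1.2.
Definition y3 n (y : depth_index n) : nat := (val y).2.

Definition is_depth_triangle n (f : {ffun depth_index n -> int}) : bool :=
  [&& [forall y, (y2 y == 0%N) ==> (f y == 0)],
      (* z = (y1, y2 - 1, y3 + 1) *)
      [forall y, forall z,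
        [&& y1 z == y1 y, (y2 z).+1 == y2 y & y3 z == (y3 y).+1] ==>
        (`|f y - f z| == 1)] &
      (* z = (y1 + 1, y2 - 1, y3) *)
      [forall y, forall z,
        [&& y1 z == (y1 y).+1, (y2 z).+1 == y2 y & y3 z == y3 y] ==>
        (`|f y - f z| == 1)]].

Record depth_triangle n := DepthTriangle
  { depth_fun :> {ffun depth_index n -> int};
    depth_funP : is_depth_triangle depth_fun }.

HB.instance Definition _ n := [isSub for @depth_fun n].
HB.instance Definition _ n := [Countable of depth_triangle n by <:].

(* Main.v *)
(* In a finite distributive lattice, a congruence amounts to a set S of
   join-prime elements: two elements are congruent iff they lie above the same
   members of S.  The join-primes of the quotient then form the subposet S, so
   the catalan congruences are the images of the order embeddings of the poset
   D_n of join-primes of Dyck_n into that of ASM_n.  The latter is the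
   tetrahedral poset of the (t1, t2, t3, t4) in N^4 of sum n - 2, where going
   down transfers a unit from {t2, t3} to {t1, t4}; in D_n going down transfers
   a unit from y2 to y1 or y3.  Embeddings preserve the rank (t2 + t3, resp.
   y2).  On the n - 1 minimal elements they preserve adjacency, so up to the
   reflection of D_n they are the identity there, whence y is sent to some
   (y1, a, b, y3) with a + b = y2.  The map y |-> a - b is the depth triangle
   of the congruence. *)
From HB Require Import structures.
Require Import Defs.
From mathcomp Require Import all_boot all_order all_algebra zify.

Set Implicit Arguments.
Unset Strict Implicit.
Unset Printing Implicit Defensive.

Import Order.TTheory GRing.Theory Num.Theory.

(** * Congruences of a finite distributive lattice through its join-primes *)

Section Lattices.
Local Open Scope order_scope.
Local Open Scope quotient_scope.

(** By separation every element is the join of the [J p] below it, so [J] lists without repetition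
    exactly the join-primes of [L]; the order on [P] is pulled back along [J]. *)
Record join_basis d (L : finLatticeType d) (P : finType) (J : P -> L) (bot : L)
    : Prop := JoinBasis {
  jb_prime : forall p A B, (J p <= A `|` B) = (J p <= A) || (J p <= B);
  jb_sep : forall A B, (forall p, J p <= A -> J p <= B) -> A <= B;
  jb_bot : forall p, (J p <= bot) = false;
  jb_inj : injective J }.

Section JoinBasis.
Context {d : Order.disp_t} (L : finLatticeType d) (P : finType).
Variables (J : P -> L) (bot : L).
Hypothesis JB : join_basis J bot.
Implicit Types (A B : L) (p q : P) (S : {set P}).

Lemma jb_eq A B : (forall p, (J p <= A) = (J p <= B)) -> A = B.
Proof.
by move=> AB; apply/le_anti/andP; split; apply: (jb_sep JB) => p; rewrite AB.
Qed.

Lemma jb_bot_le A : bot <= A.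
Proof. by apply: (jb_sep JB) => p; rewrite (jb_bot JB). Qed.

Definition jsup S : L := \big[Order.join/bot]_(p in S) J p.

Lemma le_jsup p S : (J p <= jsup S) = [exists q in S, J p <= J q].
Proof.
rewrite /jsup -big_enum /=.
transitivity (has (fun q => J p <= J q) (enum S)).
  elim: (enum S) => [|q s IH]; first by rewrite big_nil (jb_bot JB).
  by rewrite big_cons (jb_prime JB) IH.
apply/hasP/exists_inP => [[q]|[q qS pq]]; first by rewrite mem_enum; exists q.
by exists q => //; rewrite mem_enum.
Qed.

Definition jcongr_set S : {set L * L} :=
  [set u | [forall p in S, (J p <= u.1) == (J p <= u.2)]].

Lemma jcongr_setP S A B : reflect
  {in S, forall p, (J p <= A) = (J p <= B)} ((A, B) \in jcongr_set S).
Proof.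
by rewrite inE /=; apply: (iffP forall_inP) => H p pS; apply/eqP; rewrite H.
Qed.

Lemma jcongr_subproof S : is_congruence (jcongr_set S).
Proof.
apply/and4P; split.
- by apply/forallP=> A; apply/jcongr_setP.
- apply/forallP=> A; apply/forallP=> B; apply/implyP=> /jcongr_setP H.
  by apply/jcongr_setP=> p /H.
- apply/forallP=> A; apply/forallP=> B; apply/forallP=> C.
  apply/implyP=> /jcongr_setP H; apply/implyP=> /jcongr_setP K.
  by apply/jcongr_setP=> p pS; rewrite H // K.
apply/forallP=> A; apply/forallP=> A'; apply/forallP=> B; apply/forallP=> B'.
apply/implyP=> /jcongr_setP H; apply/implyP=> /jcongr_setP K.
by apply/andP; split; apply/jcongr_setP=> p pS;
  rewrite ?lexI ?(jb_prime JB) H // K.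
Qed.

Definition jcongr S : congruence L := Congruence (jcongr_subproof S).

Lemma jcongrP S A B : reflect
  {in S, forall p, (J p <= A) = (J p <= B)} (congr (jcongr S) A B).
Proof. exact: jcongr_setP. Qed.

(* The elements [J p] and the join of all [J q] with [J q < J p] are separated
   by [J p] only. *)
Lemma jcongr_inj : injective jcongr.
Proof.
suff sub S S' : jcongr S = jcongr S' -> S \subset S'.
  by move=> S S' E; apply/eqP; rewrite eqEsubset !sub.
move=> E; apply/subsetP=> p pS; apply: contraT => pS'.
pose A := jsup [set q | (J q <= J p) && (q != p)].
have AE q : (J q <= A) = (J q <= J p) && (q != p).
  rewrite le_jsup; apply/exists_inP/andP => [[r]|[qp nqp]]; last first.
    by exists q; rewrite ?inE ?qp.
  rewrite inE => /andP[rp nrp] qr; split; first exact: le_trans rp.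
  apply: contraNneq nrp => qp; apply/eqP/(jb_inj JB)/le_anti.
  by rewrite rp -qp qr.
have /jcongrP/(_ p pS) : congr (jcongr S) (J p) A.
  rewrite E; apply/jcongrP=> q qS'; rewrite AE.
  by rewrite (_ : q != p) ?andbT //; apply: contraNneq pS' => <-.
by rewrite AE lexx eqxx.
Qed.

End JoinBasis.

(** * Quotients of a lattice and embeddings of join-primes *)

Section Quotient.
Context {d d' : Order.disp_t} (L : finLatticeType d) (M : finLatticeType d').
Context (P Q : finType) (J : P -> L) (K : Q -> M) (bot : L) (bot' : M).
Hypotheses (JB : join_basis J bot) (KB : join_basis K bot').

(** The [A] with [K y <= g A] are closed under meets, hence have a least element. It is the join of
    the [J p] below it, and primality of [K y] puts [K y] below a single [g (J p)], so that this
    [J p] is the least element. *)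
Lemma join_prime_preimage (g : L -> M) (y : Q) :
    (forall m, exists A, g A = m) ->
    {morph g : A B / A `&` B} -> {morph g : A B / A `|` B} ->
  exists p, forall A, (K y <= g A) = (J p <= A).
Proof.
move=> gS gM gJ.
have g_le A B : A <= B -> g A <= g B by rewrite !leEmeet -gM => /eqP->.
have gbot : (K y <= g bot) = false.
  have [A gA] := gS bot'; apply: contraFF (jb_bot KB y) => /le_trans->//.
  by rewrite -gA g_le // (jb_bot_le JB).
have below A : K y <= g A -> exists2 p, J p <= A & K y <= g (J p).
  have -> : A = jsup J bot [set p | J p <= A].
    apply: (jb_eq JB) => p; rewrite (le_jsup JB).
    apply/idP/exists_inP => [pA|[q]]; first by exists p; rewrite ?inE.
    by rewrite inE => qA /le_trans->.
  rewrite {1}/jsup (big_morph g gJ erefl) -big_enum /=.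
  suff aux s : {subset s <= [set p | J p <= A]} ->
      K y <= \big[Order.join/g bot]_(p <- s) g (J p) ->
      exists2 p, p \in [set p | J p <= A] & K y <= g (J p).
    case/aux=> [p|p pA yp]; first by rewrite mem_enum.
    by exists p => //; rewrite (le_jsup JB); apply/exists_inP; exists p.
  elim: s => [_|p s IH sA]; first by rewrite big_nil gbot.
  rewrite big_cons (jb_prime KB) => /orP[yp|].
    by exists p => //; apply/sA/mem_head.
  by apply: IH => q qs; apply: sA; rewrite inE qs orbT.
have [A1 gA1] := gS (K y).
have yA1 : K y <= g A1 by rewrite gA1.
(* Minimising the size of the down-set gives the least element: meeting [A0] with another solution
   [A] cannot shrink its down-set, so [A0 <= A]. *)
have [A0 yA0 A0min] := @arg_minnP L A1 (fun A => K y <= g A)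
  (fun A => #|[set B | B <= A]|) yA1.
have A0_le A : K y <= g A -> A0 <= A.
  move=> yA; have yI : K y <= g (A `&` A0) by rewrite gM lexI yA.
  have sub : [set B | B <= A `&` A0] \subset [set B | B <= A0].
    by apply/subsetP=> B; rewrite !inE lexI => /andP[].
  have : [set B | B <= A `&` A0] == [set B | B <= A0].
    by rewrite eqEcard sub A0min.
  by move/eqP/setP/(_ A0); rewrite !inE lexI !lexx andbT => ->.
have [p pA0 yp] := below A0 yA0; exists p => A; apply/idP/idP => [yA|pA].
  exact/(le_trans pA0)/A0_le.
exact/(le_trans yp)/g_le.
Qed.

(** Birkhoff duality: a surjective morphism [g] from [L] to [M] and an order embedding [phi] from
    [Q] to [P] determine each other by [K y <= g A] iff [J (phi y) <= A], and the kernel of [g] only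
    sees the image of [phi]. *)
Lemma quotient_iso_basis (th : congruence L) :
  lattice_iso (quotient_lattice th) M <->
  exists phi : Q -> P,
    (forall y z, (J (phi y) <= J (phi z)) = (K y <= K z)) /\
    th = jcongr JB [set phi y | y : Q].
Proof.
have piP A B : \pi_(quotient_lattice th) A = \pi B <-> congr th A B.
  by split=> /(@eqquotP _ (congr_equiv th) (quotient_lattice th)).
split=> [/lattice_isoP[f [[f' fK f'K] fM fJ]]|[phi [phiE thE]]].
  pose g A := f (\pi A).
  have gS m : exists A, g A = m.
    by exists (repr (f' m)); rewrite /g reprK f'K.
  have gM : {morph g : A B / A `&` B}.
    by move=> A B; rewrite /g -fM -qmeetE.
  have gJ : {morph g : A B / A `|` B}.
    by move=> A B; rewrite /g -fJ -qjoinE.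
  have [phi phiP] := fin_all_exists (fun y => join_prime_preimage y gS gM gJ).
  exists phi; split=> [y z|].
    apply/idP/idP => [yz|yz].
      have [B gB] := gS (K z); rewrite -gB phiP; apply: (le_trans yz).
      by rewrite -phiP gB.
    by rewrite -phiP (le_trans yz) // phiP.
  apply: val_inj; apply/setP=> -[A B] /=; apply/idP/jcongr_setP => [AB|AB].
    by move=> _ /imsetP[y _ ->]; rewrite -!phiP /g (piP A B).2.
  apply/piP; apply: (can_inj fK); apply: (jb_eq KB) => y.
  by rewrite !phiP AB // imset_f.
pose g A := jsup K bot' [set y | J (phi y) <= A].
have gE y A : (K y <= g A) = (J (phi y) <= A).
  rewrite (le_jsup KB); apply/exists_inP/idP => [[z]|yA].
    by rewrite inE -phiE => zA /le_trans->.
  by exists y; rewrite ?inE.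
have gM : {morph g : A B / A `&` B}.
  by move=> A B; apply: (jb_eq KB) => y; rewrite lexI !gE lexI.
have gJ : {morph g : A B / A `|` B}.
  by move=> A B; apply: (jb_eq KB) => y; rewrite (jb_prime KB) !gE (jb_prime JB).
have g_congr A B : congr th A B <-> g A = g B.
  rewrite thE; split=> [/jcongrP AB|AB].
    by apply: (jb_eq KB) => y; rewrite !gE AB // imset_f.
  by apply/jcongrP=> _ /imsetP[y _ ->]; rewrite -!gE AB.
pose f (a : quotient_lattice th) := g (repr a).
have fpi A : f (\pi A) = g A by apply/g_congr/congr_repr.
(* The inverse takes [m] to the class of the least [A] with [m <= g A]. *)
pose f' m : quotient_lattice th :=
  \pi_(quotient_lattice th)
    (jsup J bot [set phi y | y in [set y | K y <= m]] : L).
apply/lattice_isoP; exists f; split.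
- exists f' => [a|m].
    elim/quotW: a => A; rewrite fpi; apply/piP/g_congr; apply: (jb_eq KB) => y.
    rewrite !gE (le_jsup JB); apply/exists_inP/idP => [[x /imsetP[z]]|yA].
      by rewrite inE gE => zA -> /le_trans->.
    by exists (phi y) => //; rewrite imset_f // inE gE.
  rewrite fpi; apply: (jb_eq KB) => y; rewrite gE (le_jsup JB).
  apply/exists_inP/idP => [[x /imsetP[z]]|ym].
    by rewrite inE => zm ->; rewrite phiE => /le_trans->.
  by exists (phi y) => //; rewrite imset_f // inE.
- move=> a b; elim/quotW: a => A; elim/quotW: b => B.
  by transitivity (f (\pi_(quotient_lattice th) (A `&` B : L)));
    [rewrite -qmeetE | rewrite !fpi gM].
move=> a b; elim/quotW: a => A; elim/quotW: b => B.
by transitivity (f (\pi_(quotient_lattice th) (A `|` B : L)));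
  [rewrite -qjoinE | rewrite !fpi gJ].
Qed.

End Quotient.

End Lattices.

Local Open Scope ring_scope.

(** * The tetrahedral poset *)

Definition tetra n :=
  {x : 'I_n * 'I_n * 'I_n * 'I_n |
    (x.1.1.1 + x.1.1.2 + x.1.2 + x.2 + 2 == n)%N}.

HB.instance Definition _ n := Finite.on (tetra n).

Section Tetra.
Variable n : nat.
Implicit Types x : tetra n.

Definition t1 x : nat := (val x).1.1.1.
Definition t2 x : nat := (val x).1.1.2.
Definition t3 x : nat := (val x).1.2.
Definition t4 x : nat := (val x).2.

Lemma tetra_sum x : (t1 x + t2 x + t3 x + t4 x + 2 = n)%N.
Proof. exact/eqP/(valP x). Qed.

Lemma tetra_ext x x' : t1 x = t1 x' -> t2 x = t2 x' -> t4 x = t4 x' -> x = x'.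
Proof.
move=> h1 h2 h4; have h3 : t3 x = t3 x'.
  by have := tetra_sum x; have := tetra_sum x'; lia.
apply: val_inj; move: h1 h2 h3 h4; rewrite /t1 /t2 /t3 /t4.
case: (val x) => -[[a b] c] e; case: (val x') => -[[a' b'] c'] e' /=.
by move=> /val_inj-> /val_inj-> /val_inj-> /val_inj->.
Qed.

Lemma tetra_ex a b c e : (a + b + c + e + 2 = n)%N ->
  exists x, [/\ t1 x = a, t2 x = b, t3 x = c & t4 x = e].
Proof.
move=> s; have [ha hb hc he] : [/\ a < n, b < n, c < n & e < n]%N by split; lia.
have h : (Ordinal ha + Ordinal hb + Ordinal hc + Ordinal he + 2 == n)%N.
  exact/eqP.
by exists (exist _ (Ordinal ha, Ordinal hb, Ordinal hc, Ordinal he) h).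
Qed.

Definition tetra_le x x' : bool :=
  [&& t1 x' <= t1 x, t4 x' <= t4 x, t2 x <= t2 x' & t3 x <= t3 x']%N.

End Tetra.

(** * Join-primes of the lattice of alternating sign matrices *)

Section AsmJoinBasis.
Variable n : nat.
Implicit Types (A B : asm n) (x : tetra n).

(** Steps are 0 or 1: counting them from the top and left edges gives the first three bounds,
    counting back from the right edge the last. *)
Lemma corner_fun_bounds c : corner_fun n c ->
  forall i j, (i <= n)%N -> (j <= n)%N ->
    [/\ 0 <= c i j, c i j <= i%:Z, c i j <= j%:Z & (i + j)%:Z - n%:Z <= c i j].
Proof.
case=> c0 c0' cn cn' cS.
have S i j : (i < n)%N -> (j <= n)%N ->
    (c i j <= c i.+1 j <= c i j + 1) && (c j i <= c j i.+1 <= c j i + 1).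
  by move=> lin ljn; rewrite -!step01 cS.
have up i j : (i <= n)%N -> (j <= n)%N -> 0 <= c i j <= i%:Z.
  move=> lin ljn; elim: i lin => [|i IH] lin; first by rewrite c0.
  by have := IH (ltnW lin); have := S i j lin ljn; lia.
have right i j : (i <= n)%N -> (j <= n)%N -> c i j <= j%:Z.
  move=> lin; elim: j => [|j IH] ljn; first by rewrite c0'.
  by have := IH (ltnW ljn); have := S j i ljn lin; lia.
have down i k : (i <= n)%N -> (k <= n)%N -> i%:Z - k%:Z <= c i (n - k)%N.
  move=> lin; elim: k => [|k IH] lkn; first by rewrite subn0 cn //; lia.
  have lt : (n - k.+1 < n)%N by lia.
  have := IH (ltnW lkn); have := S _ i lt lin.
  by rewrite (_ : (n - k.+1).+1 = n - k)%N; lia.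
move=> i j lin ljn; split; rewrite ?right //.
- by case/andP: (up i j lin ljn).
- by case/andP: (up i j lin ljn).
have := down i (n - j)%N lin (leq_subr _ _).
by rewrite subKn //; lia.
Qed.

(** The subtractions are truncated: moving to a larger index raises the value by at most the
    distance, moving to a smaller one never raises it. *)
Lemma corner_fun_lip c : corner_fun n c ->
  forall i i' j j', (i <= n)%N -> (i' <= n)%N -> (j <= n)%N -> (j' <= n)%N ->
    c i' j' <= c i j + (i' - i)%N%:Z + (j' - j)%N%:Z.
Proof.
case=> c0 c0' cn cn' cS.
have S i j : (i < n)%N -> (j <= n)%N ->
    (c i j <= c i.+1 j <= c i j + 1) && (c j i <= c j i.+1 <= c j i + 1).
  by move=> lin ljn; rewrite -!step01 cS.
have upD i k j : (i + k <= n)%N -> (j <= n)%N ->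
    (c i j <= c (i + k)%N j <= c i j + k%:Z) &&
    (c j i <= c j (i + k)%N <= c j i + k%:Z).
  move=> + ljn; elim: k => [|k IH] lin; first by rewrite addn0; lia.
  rewrite addnS in lin *; have := IH (ltnW lin); have := S _ _ lin ljn; lia.
move=> i i' j j' lin lin' ljn ljn'.
have h1 : c i' j' <= c i j' + (i' - i)%N%:Z.
  have [ii'|i'i] := leqP i i'.
    by have := upD i (i' - i)%N j'; rewrite subnKC // => /(_ lin' ljn'); lia.
  have := upD i' (i - i')%N j'; rewrite subnKC ?(ltnW i'i) // => /(_ lin ljn').
  by lia.
have h2 : c i j' <= c i j + (j' - j)%N%:Z.
  have [jj'|j'j] := leqP j j'.
    by have := upD j (j' - j)%N i; rewrite subnKC // => /(_ ljn' lin); lia.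
  have := upD j' (j - j')%N i; rewrite subnKC ?(ltnW j'j) // => /(_ ljn lin).
  by lia.
lia.
Qed.

(* The largest corner sum function whose value at (t1 + t2 + 1, t1 + t3 + 1) is
   at most t1. *)
Definition asm_prime_corner x (i j : nat) : int :=
  (minn (minn i j)
     (t1 x + (i - (t1 x + t2 x).+1) + (j - (t1 x + t3 x).+1)))%N%:Z.

Lemma asm_prime_cornerP x : corner_fun n (asm_prime_corner x).
Proof.
rewrite /asm_prime_corner; have := tetra_sum x.
move: (t1 x) (t2 x) (t3 x) (t4 x) => a b c e abce.
by split=> [j|i|i lin|j ljn|i j lin ljn]; rewrite ?inE; lia.
Qed.

Definition asm_prime x : asm n := asm_of_corner (asm_prime_cornerP x).

(** The corner sums of the identity matrix, whose height function |i - j| is the least. *)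
Lemma asm_bot_cornerP : corner_fun n (fun i j => (minn i j)%:Z).
Proof. by split=> [j|i|i lin|j ljn|i j lin ljn]; rewrite ?inE; lia. Qed.

Definition asm_bot : asm n := asm_of_corner asm_bot_cornerP.

(** The order reverses corner sums. The bounds by [i] and [j] and the Lipschitz bound from the given
    position are the three terms of the minimum in [asm_prime_corner]. *)
Lemma asm_prime_le x A :
  (asm_prime x <= A)%O =
  (corner_sum A (t1 x + t2 x).+1 (t1 x + t3 x).+1 <= (t1 x)%:Z).
Proof.
have sx := tetra_sum x.
have [hi hj] : ((t1 x + t2 x).+1 <= n /\ (t1 x + t3 x).+1 <= n)%N by lia.
apply/asm_leP/idP => [H|H i j lin ljn].
  apply: le_trans (H _ _ hi hj) _.
  by rewrite (mx_of_cornerK (asm_prime_cornerP x)) // /asm_prime_corner; lia.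
rewrite (mx_of_cornerK (asm_prime_cornerP x)) // /asm_prime_corner.
have [h1 h2 h3 h4] := corner_fun_bounds (asm_corner A) lin ljn.
by have := corner_fun_lip (asm_corner A) hi lin hj ljn; lia.
Qed.

Lemma asm_prime_leE x x' : (asm_prime x <= asm_prime x')%O = tetra_le x x'.
Proof.
have := tetra_sum x; have := tetra_sum x' => sx' sx.
have [hi hj] : ((t1 x + t2 x).+1 <= n /\ (t1 x + t3 x).+1 <= n)%N by lia.
rewrite asm_prime_le (mx_of_cornerK (asm_prime_cornerP x')) //.
rewrite /asm_prime_corner /tetra_le; apply/idP/idP; lia.
Qed.

(** Primality holds because lying above [asm_prime x] bounds a single corner sum and joins take
    minima of corner sums. *)
Lemma asm_join_basis : join_basis asm_prime asm_bot.
Proof.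
split=> [x A B|A B H|x|x x' E].
- have := tetra_sum x => sx.
  rewrite !asm_prime_le (mx_of_cornerK (corner_min A B)); last 2 first.
  + by lia.
  + by lia.
  by rewrite ge_min.
- apply/asm_leP=> i j lin ljn; rewrite leNgt; apply/negP=> lt.
  have [a1 a2 a3 a4] := corner_fun_bounds (asm_corner A) lin ljn.
  have [b1 b2 b3 b4] := corner_fun_bounds (asm_corner B) lin ljn.
  have cE := gez0_abs a1; move: {+}`|corner_sum A i j|%N cE => k cE.
  (* This [x] tests whether the corner sum at [(i, j)] is at most [k]: [A] passes and [B] fails. The
     subtractions are exact, since [k] is less than the corner sum of [B], itself at most [i] and
     [j], and [i + j - n <= k]. *)
  have [|x [x1 x2 x3 x4]] := @tetra_ex n k (i - k.+1) (j - k.+1) (n + k - i - j).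
    by lia.
  have := H x; rewrite !asm_prime_le x1 x2 x3.
  rewrite (_ : (k + (i - k.+1)).+1 = i); last by lia.
  rewrite (_ : (k + (j - k.+1)).+1 = j); last by lia.
  by rewrite -cE lexx => /(_ isT); lia.
- have := tetra_sum x => sx.
  by rewrite asm_prime_le (mx_of_cornerK asm_bot_cornerP); lia.
have /andP[] : tetra_le x x' && tetra_le x' x by rewrite -!asm_prime_leE E lexx.
by rewrite /tetra_le => h h'; apply: tetra_ext; lia.
Qed.

End AsmJoinBasis.

(** * Join-primes of the Stanley lattice *)

Section DyckJoinBasis.
Local Open Scope nat_scope.
Variable n : nat.
Implicit Types (P Q : dyck n) (y z : depth_index n).

Lemma depth_index_sum y : (y1 y + y2 y + y3 y + 2 = n)%N.
Proof. exact/eqP/(valP y). Qed.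

Lemma depth_index_ext y z : y1 y = y1 z -> y3 y = y3 z -> y = z.
Proof.
move=> h1 h3; have h2 : y2 y = y2 z.
  by have := depth_index_sum y; have := depth_index_sum z; lia.
apply: val_inj; move: h1 h2 h3; rewrite /y1 /y2 /y3.
case: (val y) => -[a b] c; case: (val z) => -[a' b'] c' /=.
by move=> /val_inj-> /val_inj-> /val_inj->.
Qed.

Lemma depth_index_ex a b c : (a + b + c + 2 = n)%N ->
  exists y : depth_index n, [/\ y1 y = a, y2 y = b & y3 y = c].
Proof.
move=> s; have [ha hb hc] : [/\ a < n, b < n & c < n]%N by split; lia.
have h : (Ordinal ha + Ordinal hb + Ordinal hc + 2 == n)%N by exact/eqP.
by exists (exist _ (Ordinal ha, Ordinal hb, Ordinal hc) h).
Qed.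

Definition depth_le y z : bool := (y1 z <= y1 y)%N && (y3 z <= y3 y)%N.

Lemma ups_lip u : ups_fun n u -> forall k k', (k <= n.*2)%N -> (k' <= n.*2)%N ->
  (u k <= u k' + (k - k'))%N.
Proof.
case=> _ _ uS _.
have H k l : (k + l <= n.*2)%N -> (u k <= u (k + l) <= u k + l)%N.
  elim: l => [|l IH] kl; first by rewrite !addn0 leqnn.
  by rewrite !addnS in kl *; have := IH (ltnW kl); have := uS _ kl; lia.
move=> k k' kn kn'; have [kk'|k'k] := leqP k k'.
  by have := H k (k' - k)%N; rewrite subnKC // => /(_ kn'); lia.
by have := H k' (k - k')%N; rewrite subnKC ?(ltnW k'k) // => /(_ kn); lia.
Qed.

(* The smallest path with at least y1 + y2 + 2 ups among its first
   2 y1 + y2 + 2 steps. *)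
Definition dyck_prime_ups y (k : nat) : nat :=
  maxn (uphalf k) ((y1 y + y2 y).+2 - ((y1 y).*2 + y2 y + 2 - k)).

Lemma dyck_prime_upsP y : ups_fun n (dyck_prime_ups y).
Proof.
rewrite /dyck_prime_ups; have := depth_index_sum y.
by move: (y1 y) (y2 y) (y3 y) => a b c abc; split=> [||k kn|k kn]; lia.
Qed.

Definition dyck_prime y : dyck n := dyck_of (dyck_prime_upsP y).

(** The zigzag path, alternately up and down, is the lowest Dyck path. *)
Lemma dyck_bot_upsP : ups_fun n uphalf.
Proof. by split=> [||k kn|k kn]; lia. Qed.

Definition dyck_bot : dyck n := dyck_of dyck_bot_upsP.

(** The condition asks for height at least y2 + 2 after 2 y1 + y2 + 2 steps. The two terms of
    [dyck_prime_ups] are the bound by the zigzag path and the one from [ups_lip]. *)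
Lemma dyck_prime_le y P :
  (dyck_prime y <= P)%O =
  ((y1 y + y2 y).+2 <= ups P ((y1 y).*2 + y2 y + 2))%N.
Proof.
have sy := depth_index_sum y.
have hk : ((y1 y).*2 + y2 y + 2 <= n.*2)%N by lia.
apply/dyck_leP/idP => [H|H k kn].
  apply: leq_trans (H _ hk).
  by rewrite (path_ofK (dyck_prime_upsP y)) // /dyck_prime_ups; lia.
rewrite (path_ofK (dyck_prime_upsP y)) // /dyck_prime_ups.
have [_ _ _ ge_half] := dyck_ups P.
by have := ge_half k kn; have := ups_lip (dyck_ups P) hk kn; lia.
Qed.

Lemma dyck_prime_leE y z : (dyck_prime y <= dyck_prime z)%O = depth_le y z.
Proof.
have := depth_index_sum y; have := depth_index_sum z => sz sy.
rewrite dyck_prime_le (path_ofK (dyck_prime_upsP z)); last by lia.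
by rewrite /dyck_prime_ups /depth_le; apply/idP/idP; lia.
Qed.

Lemma dyck_join_basis : join_basis dyck_prime dyck_bot.
Proof.
split=> [y P Q|P Q H|y|y z E].
- have := depth_index_sum y => sy.
  rewrite !dyck_prime_le (path_ofK (ups_max P Q)); last by lia.
  by rewrite leq_max.
- apply/dyck_leP=> k kn; rewrite leqNgt; apply/negP=> lt.
  have [_ _ _ Qh] := dyck_ups Q; have [P0 Pn _ _] := dyck_ups P.
  have := Qh k kn => hQ.
  have Pk := ups_lip (dyck_ups P) kn (leq0n _); rewrite P0 in Pk.
  have Pn' := ups_lip (dyck_ups P) kn (leqnn _); rewrite Pn in Pn'.
  (* This [y] tests whether a path has [ups P k] ups after [k] steps. Its middle coordinate is an
     exact subtraction because [Q] has fewer ups than [P] and at least half of [k]. *)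
  have [|y [h1 h2 h3]] :=
      @depth_index_ex (k - ups P k) ((ups P k).*2 - k - 2) (n - ups P k).
    by lia.
  have := H y; rewrite !dyck_prime_le h1 h2.
  rewrite (_ : (_ + _).+2 = ups P k); last by lia.
  rewrite (_ : (_ + _ + 2)%N = k); last by lia.
  by rewrite leqnn => /(_ isT); lia.
- have := depth_index_sum y => sy.
  by rewrite dyck_prime_le (path_ofK dyck_bot_upsP); lia.
have /andP[] : depth_le y z && depth_le z y by rewrite -!dyck_prime_leE E lexx.
by rewrite /depth_le => h h'; apply: depth_index_ext; lia.
Qed.

End DyckJoinBasis.

(** * From depth triangles to embeddings *)

Section DepthTriangleSet.
Variable n : nat.
Implicit Types (y z : depth_index n) (x : tetra n).

(** Defined for any [f]: an index [y] contributes nothing if [f y] differs from [y2 y] in parity or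
    exceeds it in absolute value. *)
Definition depth_set (f : depth_index n -> int) : {set tetra n} :=
  [set x | [exists y, [&& t1 x == y1 y, t4 x == y3 y &
                         (t2 x)%:Z - (t3 x)%:Z == f y]]].

Lemma depth_set_inj (f g : depth_index n -> int) :
    (forall y, exists x,
      [/\ t1 x = y1 y, t4 x = y3 y & (t2 x)%:Z - (t3 x)%:Z = f y]) ->
  depth_set f = depth_set g -> f =1 g.
Proof.
move=> fx E y; have [x [h1 h4 hf]] := fx y.
have : x \in depth_set f.
  by rewrite inE; apply/existsP; exists y; rewrite h1 h4 hf !eqxx.
rewrite E inE => /existsP[z /and3P[/eqP k1 /eqP k4 /eqP kg]].
by rewrite -hf kg; congr (g _); apply: depth_index_ext; lia.
Qed.

Lemma depth_triangle0 (f : depth_triangle n) y : y2 y = 0%N -> f y = 0.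
Proof.
move=> y20; have /and3P[/forallP/(_ y) + _ _] := depth_funP f.
by rewrite y20 => /implyP/(_ isT)/eqP.
Qed.

Lemma depth_triangle_step (f : depth_triangle n) y z :
  (y1 y <= y1 z)%N -> (y3 y <= y3 z)%N -> (y2 z).+1 = y2 y -> `|f y - f z| = 1.
Proof.
move=> h1 h3 h2; have := depth_index_sum y; have := depth_index_sum z => sz sy.
have /and3P[_ /forallP/(_ y)/forallP/(_ z)/implyP f1
              /forallP/(_ y)/forallP/(_ z)/implyP f2] := depth_funP f.
have [e|e] : y1 z = y1 y /\ y3 z = (y3 y).+1 \/ y1 z = (y1 y).+1 /\ y3 z = y3 y.
  lia.
  by apply/eqP/f1; case: e => -> ->; rewrite h2 !eqxx.
by apply/eqP/f2; case: e => -> ->; rewrite h2 !eqxx.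
Qed.

Lemma depth_lower_ex y : (0 < y2 y)%N ->
  exists z, [/\ y1 z = (y1 y).+1, y3 z = y3 y & (y2 z).+1 = y2 y].
Proof.
move=> y2_gt0; have := depth_index_sum y => sy.
have [|z [z1 z2 z3]] := @depth_index_ex n (y1 y).+1 (y2 y).-1 (y3 y); first by lia.
by exists z; split=> //; lia.
Qed.

(** Add up the unit steps along a chain of covers. With a + b = y2 and a - b = [f y], the bound says
    that neither a nor b decreases from [y] to [z], which is order preservation. *)
Lemma depth_triangle_lip (f : depth_triangle n) y z :
  depth_le y z -> `|f z - f y| <= (y2 z)%:Z - (y2 y)%:Z.
Proof.
have [k] := ubnP (y2 z - y2 y)%N; elim: k z => // k IH z lt yz.
have := depth_index_sum y; have := depth_index_sum z => sz sy.
have /andP[le1 le3] := yz.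
have [e|ne] := eqVneq (y2 y) (y2 z).
  have -> : y = z by apply: depth_index_ext; lia.
  by rewrite !subrr normr0.
(* A lower cover of [z] still above [y], obtained by raising an outer coordinate in which [z] is
   short of [y]. *)
have [w [w1 w3 w2 yw]] : exists w, [/\ y1 z <= y1 w, y3 z <= y3 w,
    (y2 w).+1 = y2 z & depth_le y w]%N.
  have [lt1|ge1] := ltnP (y1 z) (y1 y).
    have [|w [w1 w3 w2]] := @depth_lower_ex z; first by lia.
    by exists w; rewrite /depth_le; split; lia.
  have [|w [w1 w2 w3]] := @depth_index_ex n (y1 z) (y2 z).-1 (y3 z).+1.
    by lia.
  by exists w; rewrite /depth_le; split; lia.
have := depth_triangle_step f w1 w3 w2.
have sw := depth_index_sum w; have lt' : (y2 w - y2 y < k)%N by lia.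
by have := IH w lt' yw; lia.
Qed.

(** Start from rank 0, where [f] vanishes; each cover changes [f] by 1 or -1, which one more unit in
    a or in b absorbs. *)
Lemma depth_triangle_coord (f : depth_triangle n) y :
  exists x, [/\ t1 x = y1 y, t4 x = y3 y & (t2 x)%:Z - (t3 x)%:Z = f y].
Proof.
suff [a [b [ab fE]]] : exists a b : nat, (a + b = y2 y)%N /\ a%:Z - b%:Z = f y.
  have := depth_index_sum y => sy.
  have [|x [x1 x2 x3 x4]] := @tetra_ex n (y1 y) a b (y3 y); first by lia.
  by exists x; rewrite x1 x2 x3 x4.
move: {2}(y2 y) (erefl (y2 y)) => k; elim: k y => [|k IH] y yk.
  by exists 0%N, 0%N; rewrite yk depth_triangle0.
have [|z [z1 z3 z2]] := @depth_lower_ex y; first by lia.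
have [|a [b [ab fE]]] := IH z; first by lia.
have := @depth_triangle_step f y z.
rewrite z1 z3 z2 leqnn leqnSn => /(_ isT isT erefl) st.
have [e|e] : f y = f z + 1 \/ f y = f z - 1 by lia.
  by exists a.+1, b; split; lia.
by exists a, b.+1; split; lia.
Qed.

Lemma depth_triangle_embedding (f : depth_triangle n) :
  exists phi : depth_index n -> tetra n,
    (forall y z, tetra_le (phi y) (phi z) = depth_le y z) /\
    [set phi y | y : depth_index n] = depth_set f.
Proof.
have [phi phiP] := fin_all_exists (depth_triangle_coord f).
exists phi; split=> [y z|].
  have [h1 h4 hf] := phiP y; have [k1 k4 kf] := phiP z.
  have := tetra_sum (phi y); have := tetra_sum (phi z).
  have := depth_index_sum y; have := depth_index_sum z => sz sy sz' sy'.
  rewrite /tetra_le h1 h4 k1 k4; apply/idP/idP=> [|yz].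
    by rewrite /depth_le; lia.
  by have := depth_triangle_lip f yz; have := yz; rewrite /depth_le; lia.
apply/setP=> x; rewrite inE; apply/imsetP/existsP => [[y _ ->]|[y]].
  by exists y; have [-> -> ->] := phiP y; rewrite !eqxx.
case/and3P=> /eqP x1 /eqP x4 /eqP xf; exists y => //.
have [h1 h4 hf] := phiP y.
have := tetra_sum (phi y); have := tetra_sum x => sx sy.
by apply: tetra_ext; lia.
Qed.

End DepthTriangleSet.

(** * From embeddings to depth triangles *)

(** A walk with unit steps that turns back repeats the value of two steps before. An injective one
    is thus monotone, and the bound [m] fixes its starting point. *)
Lemma unit_steps_inj (m : nat) (s : nat -> nat) :
    (forall i, i <= m -> s i <= m)%N ->
    (forall i, i < m -> s i.+1 = (s i).+1 \/ s i = (s i.+1).+1)%N ->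
    (forall i j, i <= m -> j <= m -> s i = s j -> i = j)%N ->
  (forall i, i <= m -> s i = i)%N \/ (forall i, i <= m -> s i = m - i)%N.
Proof.
move=> sm st si.
have H i : (i <= m)%N -> (forall j, j <= i -> s j = s 0 + j)%N \/
                         (forall j, j <= i -> s j + j = s 0)%N.
  elim: i => [|i IH] im; first by left=> j; rewrite leqn0 => /eqP->; rewrite addn0.
  have [up|down] := IH (ltnW im); have [e|e] := st i im.
  - by left=> j; rewrite leq_eqVlt => /orP[/eqP->|/up//]; have := up i; lia.
  - case: i => [|i] in IH im up e *.
      by right=> j; case: j => [|[|]] //; lia.
    have := si i i.+2 (ltnW (ltnW im)) im.
    by have := up i (leqnSn _); have := up i.+1 (leqnn _); lia.
  - case: i => [|i] in IH im down e *.
      by left=> j; case: j => [|[|]] //; lia.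
    have := si i i.+2 (ltnW (ltnW im)) im.
    by have := down i (leqnSn _); have := down i.+1 (leqnn _); lia.
  - by right=> j; rewrite leq_eqVlt => /orP[/eqP->|/down//]; have := down i; lia.
have s0 := sm 0%N (leq0n _); have sM := sm m (leqnn _).
have [up|down] := H m (leqnn _); [left=> i im|right=> i im].
  by have := up m (leqnn _); have := up i im; lia.
by have := down m (leqnn _); have := down i im; lia.
Qed.

Section Embedding.
Variables (n : nat) (phi : depth_index n -> tetra n).
Hypothesis phiE : forall y z, tetra_le (phi y) (phi z) = depth_le y z.
Implicit Types y z : depth_index n.

Lemma embedding_inj : injective phi.
Proof.
move=> y z E; have : depth_le y z && depth_le z y.
  by rewrite -!phiE E /tetra_le !leqnn.
by rewrite /depth_le => h; apply: depth_index_ext; lia.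
Qed.

(** [phi] strictly increases rank, and both posets have ranks 0 to n - 2. Climbing from [y] to the
    top bounds the rank of its image above, descending to rank 0 bounds it below. *)
Lemma embedding_rank y : (t2 (phi y) + t3 (phi y) = y2 y)%N.
Proof.
have lt_rank z w : depth_le z w -> z != w ->
    (t2 (phi z) + t3 (phi z) < t2 (phi w) + t3 (phi w))%N.
  move=> zw; rewrite ltnNge; apply: contra_neqN => le; apply: embedding_inj.
  have := zw; rewrite -phiE /tetra_le => h.
  by have := tetra_sum (phi z); have := tetra_sum (phi w);
    move=> ? ?; apply: tetra_ext; lia.
apply/eqP; rewrite eqn_leq; apply/andP; split.
  move: {2}(y1 y + y3 y)%N (erefl (y1 y + y3 y)%N) => k.
  elim: k y => [|k IH] y yk; have := depth_index_sum y => sy.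
    by have := tetra_sum (phi y); lia.
  have [w [w1 w3 w2]] : exists w : depth_index n, [/\ y1 w <= y1 y, y3 w <= y3 y
      & (y2 y).+1 = y2 w]%N.
    have [y10|y1p] := posnP (y1 y).
      have [|w [w1 w2 w3]] := @depth_index_ex n (y1 y) (y2 y).+1 (y3 y).-1.
        by lia.
      by exists w; split; lia.
    have [|w [w1 w2 w3]] := @depth_index_ex n (y1 y).-1 (y2 y).+1 (y3 y).
      by lia.
    by exists w; split; lia.
  have sw := depth_index_sum w.
  have yw : depth_le y w by rewrite /depth_le w1 w3.
  have ne : y != w by apply/eqP => e; rewrite e in w2; lia.
  by have := lt_rank _ _ yw ne; have := IH w; lia.
move: {2}(y2 y) (erefl (y2 y)) => k; elim: k y => [|k IH] y yk.
  by rewrite yk.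
have [|z [z1 z3 z2]] := @depth_lower_ex n y; first by lia.
have zy : depth_le z y by rewrite /depth_le z1 z3 leqnSn leqnn.
have ne : z != y by apply/eqP => e; rewrite e in z2; lia.
by have := lt_rank _ _ zy ne; have := IH z; lia.
Qed.

(* The minimal elements of both posets are linearly ordered by their first
   coordinate, two being adjacent when they are covered by a common element. *)
Lemma embedding_minimal :
  (forall y, y2 y = 0%N -> t1 (phi y) = y1 y) \/
  (forall y, y2 y = 0%N -> t1 (phi y) = y3 y).
Proof.
(* [s] reads [phi] on the minimal elements as a self-map of 0, ..., n - 2, where the default value
   is never taken. *)
pose s i := if [pick y | (y1 y == i) && (y2 y == 0%N)] is Some y
            then t1 (phi y) else 0%N.
have sE y : y2 y = 0%N -> s (y1 y) = t1 (phi y).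
  move=> y20; rewrite /s; case: pickP => [z /andP[/eqP z1 /eqP z2]|/(_ y)].
    have := depth_index_sum y; have := depth_index_sum z => sz sy.
    by congr (t1 (phi _)); apply: depth_index_ext; lia.
  by rewrite y20 !eqxx.
have [n2|n2] := ltnP n 2.
  by left=> y; have := depth_index_sum y; lia.
have bot i : (i <= n - 2)%N -> exists y, [/\ y1 y = i, y2 y = 0%N & s i = t1 (phi y)].
  move=> im; have [|y [h1 h2 h3]] := @depth_index_ex n i 0 (n - 2 - i).
    by lia.
  by exists y; split; rewrite // -h1 sE.
have [i im|i im|i j im jm ij|id|rv] := @unit_steps_inj (n - 2) s.
- have [y [h1 h2 ->]] := bot i im.
  by have := tetra_sum (phi y); lia.
- have [y [h1 h2 sy]] := bot i (ltnW im); have [z [k1 k2 sz]] := bot i.+1 im.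
  (* [w] covers both [y] and [z]. Its image has rank 1, so only two minimal elements lie below it
     and their first coordinates differ by one. *)
  have [|w [w1 w2 w3]] := @depth_index_ex n i 1 (n - 3 - i); first by lia.
  have := depth_index_sum y; have := depth_index_sum z => sumz sumy.
  have : tetra_le (phi y) (phi w).
    by rewrite phiE /depth_le; lia.
  have : tetra_le (phi z) (phi w) by rewrite phiE /depth_le; lia.
  have ne : t1 (phi y) <> t1 (phi z).
    move=> E; have : phi y = phi z.
      apply: tetra_ext => //.
        by have := embedding_rank y; have := embedding_rank z; lia.
      have := embedding_rank y; have := embedding_rank z.
      by have := tetra_sum (phi y); have := tetra_sum (phi z); lia.
    by move/embedding_inj=> e; move: h1 k1; rewrite e; lia.
  have := embedding_rank y; have := embedding_rank z; have := embedding_rank w.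
  have := tetra_sum (phi y); have := tetra_sum (phi z).
  have := tetra_sum (phi w).
  by rewrite /tetra_le sy sz; lia.
- have [y [h1 h2 sy]] := bot i im; have [z [k1 k2 sz]] := bot j jm.
  rewrite -h1 -k1; congr y1; apply: embedding_inj.
  have := embedding_rank y; have := embedding_rank z.
  have := tetra_sum (phi y); have := tetra_sum (phi z) => *.
  by apply: tetra_ext; lia.
- left=> y y20; rewrite -sE // id //.
  by have := depth_index_sum y; lia.
right=> y y20; rewrite -sE // rv //; by have := depth_index_sum y; lia.
Qed.

(** The extreme minimal elements [l] and [r] below [y] give [t1 (phi y) <= y1 y] and
    [t4 (phi y) <= y3 y]; equality of ranks makes both equalities. *)
Lemma embedding_coord :
  (forall y, y2 y = 0%N -> t1 (phi y) = y1 y) ->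
  forall y, t1 (phi y) = y1 y /\ t4 (phi y) = y3 y.
Proof.
move=> min y; have sy := depth_index_sum y.
have [|l [l1 l2 l3]] := @depth_index_ex n (y1 y) 0 (y2 y + y3 y); first by lia.
have [|r [r1 r2 r3]] := @depth_index_ex n (y1 y + y2 y) 0 (y3 y); first by lia.
have : tetra_le (phi l) (phi y) by rewrite phiE /depth_le; lia.
have : tetra_le (phi r) (phi y) by rewrite phiE /depth_le; lia.
rewrite /tetra_le; have := min l l2; have := min r r2.
have := embedding_rank y; have := embedding_rank r.
have := tetra_sum (phi y); have := tetra_sum (phi r).
lia.
Qed.

Lemma embedding_depth_triangle :
  (forall y, y2 y = 0%N -> t1 (phi y) = y1 y) ->
  exists f : depth_triangle n, [set phi y | y : depth_index n] = depth_set f.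
Proof.
move=> min; have coord := embedding_coord min.
pose f := [ffun y => ((t2 (phi y))%:Z - (t3 (phi y))%:Z)%R].
(* Along a cover t2 + t3 grows by one and neither term decreases, so exactly one of them grows, by
   one. *)
have step y z : (y1 y <= y1 z)%N -> (y3 y <= y3 z)%N -> (y2 z).+1 = y2 y ->
    (`|f y - f z| == 1)%R.
  move=> h1 h3 h2; have : tetra_le (phi z) (phi y) by rewrite phiE /depth_le h1.
  rewrite !ffunE /tetra_le.
  by have := embedding_rank y; have := embedding_rank z; lia.
have fP : is_depth_triangle f.
  apply/and3P; split; apply/forallP=> y.
  - apply/implyP=> /eqP y20; rewrite ffunE.
    by have := embedding_rank y; lia.
  - apply/forallP=> z; apply/implyP=> /and3P[/eqP h1 /eqP h2 /eqP h3].
    by apply: step; lia.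
  apply/forallP=> z; apply/implyP=> /and3P[/eqP h1 /eqP h2 /eqP h3].
  by apply: step; lia.
exists (DepthTriangle fP); apply/setP=> x; rewrite inE.
apply/imsetP/existsP => [[y _ ->]|[y]].
  by exists y; rewrite /= ffunE eqxx; have [-> ->] := coord y; rewrite !eqxx.
case/and3P=> /eqP x1 /eqP x4 /eqP /=; rewrite ffunE => xf; exists y => //.
have [h1 h4] := coord y.
have := tetra_sum (phi y); have := tetra_sum x => sx sy.
by apply: tetra_ext; lia.
Qed.

End Embedding.

Lemma depth_index_rev_ex n : exists2 rev : depth_index n -> depth_index n,
  involutive rev &
  forall y, [/\ y1 (rev y) = y3 y, y2 (rev y) = y2 y & y3 (rev y) = y1 y].
Proof.
have ex (y : depth_index n) : exists z : depth_index n,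
    [/\ y1 z = y3 y, y2 z = y2 y & y3 z = y1 y].
  by apply: depth_index_ex; have := depth_index_sum y; lia.
have [rev revP] := fin_all_exists ex; exists rev => // y.
have [h1 _ h3] := revP y; have [k1 _ k3] := revP (rev y).
by apply: depth_index_ext; lia.
Qed.

(** If [phi] reverses the minimal elements, composing it with the reflection exchanging y1 and y3
    straightens it without changing its image. *)
Lemma embedding_imset n (phi : depth_index n -> tetra n) :
    (forall y z, tetra_le (phi y) (phi z) = depth_le y z) ->
  exists f : depth_triangle n, [set phi y | y : depth_index n] = depth_set f.
Proof.
move=> phiE; have [min|min] := embedding_minimal phiE.
  exact: embedding_depth_triangle.
have [rev revK revP] := depth_index_rev_ex n.
have phi'E y z : tetra_le (phi (rev y)) (phi (rev z)) = depth_le y z.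
  have [h1 _ h3] := revP y; have [k1 _ k3] := revP z.
  by rewrite phiE /depth_le h1 h3 k1 k3 andbC.
have [|f E] := embedding_depth_triangle phi'E.
  by move=> y; have [h1 h2 h3] := revP y; rewrite -h2 => /min->.
exists f; rewrite -E; apply/setP=> x; apply/imsetP/imsetP => -[y _ ->].
  by exists (rev y); rewrite ?revK.
by exists (rev y).
Qed.

(** * The bijection *)

Section Catalan.
Variable n : nat.

Definition depth_congr (f : depth_triangle n) : congruence (asm n) :=
  jcongr (asm_join_basis n) (depth_set f).

Lemma catalanP (th : congruence (asm n)) :
  is_catalan th <-> exists f, th = depth_congr f.
Proof.
have iso := quotient_iso_basis (asm_join_basis n) (dyck_join_basis n) th.
split=> [/iso[phi [phiE ->]]|[f thE]].
  have [|f E] := @embedding_imset n phi.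
    by move=> y z; rewrite -asm_prime_leE phiE dyck_prime_leE.
  by exists f; rewrite E.
have [phi [phiE imE]] := depth_triangle_embedding f.
apply/iso; exists phi; split=> [y z|]; last by rewrite imE.
by rewrite asm_prime_leE dyck_prime_leE.
Qed.

Lemma depth_congr_inj : injective depth_congr.
Proof.
move=> f g /jcongr_inj E; apply/val_inj/ffunP.
exact: depth_set_inj (depth_triangle_coord f) E.
Qed.

End Catalan.

Theorem theorem4p10 (n : nat) (hn : (0 < n)%N) :
  exists f : catalan_congruence n -> depth_triangle n, bijective f.
Proof.
have ex (th : catalan_congruence n) : exists f, catalan_congr th == depth_congr f.
  by have [f E] := (catalanP th).1 (catalan_congrP th); exists f; apply/eqP.
pose g (f : depth_triangle n) :=
  CatalanCongruence ((catalanP (depth_congr f)).2 (ex_intro _ f erefl)).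
have xE th : depth_congr (xchoose (ex th)) = th.
  by apply/esym/eqP; exact: xchooseP (ex th).
exists (fun th => xchoose (ex th)); exists g => [th|f].
  by apply: val_inj; exact: xE.
(* The chosen triangle and [f] define the same congruence, hence coincide. *)
exact: depth_congr_inj (xE (g f)).
Qed.
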